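(* Let $n\ge 1$ and let $X_1,\ldots,X_n$ be independent non-negative random variables with finite first moment such that $M_{(n)}>0$. Then the mixing factor $\theta_n=\mathbb{E}[X_{(n)}]/M_{(n)}$ satisfies $$\theta_n\leq 2-\frac1n .$$ If moreover $M_1=M_2=\cdots=M_n$, then $\theta_n\geq 1$.
   Context: For each $i$, $X_i^1,\ldots,X_i^n$ denote independent random variables with the same distribution as $X_i$, and $M_i=\mathbb{E}\left[\max(X_i^1,\ldots,X_i^n)\right]$. Also $X_{(n)}=\max(X_1,\ldots,X_n)$ and $M_{(n)}=\max(M_1,\ldots,M_n)$. An $n$-assembly is a family of $n$ independent random variables; a similar $n$-assembly is one whose members are also identically distributed; the performance of an $n$-assembly is the expected value of its maximum. The mixing factor is $\theta_n=\mathbb{E}[X_{(n)}]/M_{(n)}$. *)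

(* Defs.v *)
From HB Require Import structures.
From mathcomp Require Import all_boot all_order all_algebra.
From mathcomp Require Import all_classical all_reals all_analysis.
Set Implicit Arguments.
Unset Strict Implicit.
Unset Printing Implicit Defensive.
Import Order.TTheory GRing.Theory Num.Theory.
Import numFieldNormedType.Exports.
Local Open Scope classical_set_scope.
Local Open Scope ring_scope.
Local Open Scope ereal_scope.

(* Mutual independence: the product rule holds for every subfamily [J]. *)
Definition independent_RVs d (T : measurableType d) (R : realType)
    (P : probability T R) (I : finType) (X : I -> {RV P >-> R}) : Prop :=
  forall (J : {set I}) (B : I -> set R),
    (forall i, i \in J -> measurable (B i)) ->
    P (\bigcap_(i in [set` J]) (X i @^-1` B i)) =
    \prod_(i in J) P (X i @^-1` B i).

Definition same_distribution d (T : measurableType d) d' (T' : measurableType d')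
    (R : realType) (P : probability T R) (Q : probability T' R)
    (X : {RV P >-> R}) (Y : {RV Q >-> R}) : Prop :=
  forall B : set R, measurable B -> distribution P X B = distribution Q Y B.

(* Maximum of a nonempty family; starting the fold from a member of the family
   avoids introducing a foreign default value. *)
Definition family_max disp (V : orderType disp) (n : nat)
    (x : 'I_n.+1 -> V) : V :=
  \big[Order.max/x ord0]_(i < n.+1) x i.

Definition performance d (T : measurableType d) (R : realType)
    (P : probability T R) (n : nat) (X : 'I_n.+1 -> {RV P >-> R}) : \bar R :=
  'E_P[fun t => family_max (fun i => X i t)].

(* [Y] is a family of independent copies of [X]; the copies may live on a
   probability space other than that of [X]. *)
Definition independent_copies d (T : measurableType d) d'
    (T' : measurableType d') (R : realType)
    (P : probability T R) (Q : probability T' R) (n : nat)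
    (X : {RV P >-> R}) (Y : 'I_n.+1 -> {RV Q >-> R}) : Prop :=
  independent_RVs Y /\ forall j, same_distribution X (Y j).

(* The quotient E[X_(n)] / M_(n), where the family [M] lists the performances
   M_i of the similar assemblies.  The quotient is taken in [\bar R]; for
   integrable [X i] and M_(n) > 0 both terms are finite. *)
Definition mixing_factor d (T : measurableType d) (R : realType)
    (P : probability T R) (n : nat) (X : 'I_n.+1 -> {RV P >-> R})
    (M : 'I_n.+1 -> \bar R) : \bar R :=
  performance X / family_max M.

(* Main.v *)
Require Import Defs.
From HB Require Import structures.
From mathcomp Require Import all_boot all_order all_algebra.
From mathcomp Require Import all_classical all_reals all_analysis.
From mathcomp Require Import measurable_realfun ring.
Import Order.TTheory GRing.Theory Num.Theory.
Import numFieldNormedType.Exports.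
Local Open Scope classical_set_scope.
Local Open Scope ring_scope.
Set Implicit Arguments.
Unset Strict Implicit.

(** Write F_i for the distribution function of X_i and N for the number of
variables.  By independence and the tail formula for expectations,
E[X_(n)] is the integral over x >= 0 of 1 - prod_i F_i(x), and M_i is the
integral of 1 - F_i(x)^N ([performance_fine_cdf], [performance_copies]).  Both
bounds then come from a comparison of these integrands that holds at every x.

Lower bound.  By the inequality of arithmetic and geometric means,
prod_i F_i <= (1/N) sum_i F_i^N ([prod_le_mean_pow]), so E[X_(n)] is at least
the mean of the M_i.

Upper bound.  The constant 2 - 1/N is the total mass of weights v_i with
1 - prod_i F_i <= sum_i v_i (1 - F_i^N) everywhere ([one_sub_prod_dominated]).
The weights are read off at the level c at which the expected number of
variables above c crosses 1: there are a_i between F_i(c-) and F_i(c) with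
sum_i (1 - a_i) = 1 ([common_threshold]).  Put v_i = 1 / (1 + a_i + ... +
a_i^(N-1)).  Factoring 1 - f^N shows that v_i (1 - F_i^N) is at least 1 - a_i
on the left of c and at least 1 - F_i on the right of c.  Summed over i, these
bounds are at least 1 on the left, which dominates any probability, and
sum_i (1 - F_i) on the right, which is the union bound for 1 - prod_i F_i.
Finally v_i <= 1 - a_i + a_i / N, an equality at a_i = 0 and a_i = 1, and these
sum to 1 + (N - 1) / N.  The two equality cases are those of the
asymptotically extremal assemblies: one constant variable together with N - 1
variables that are very large with very small probability. *)

(** * Elementary inequalities *)

(** The union bound: for independent events of probabilities [F i], the
probability that one of them fails. *)
Lemma one_sub_prod_le (R : numDomainType) (I : Type) (s : seq I)
    (F : I -> R) (F01 : forall i, 0 <= F i <= 1) :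
  1 - \prod_(i <- s) F i <= \sum_(i <- s) (1 - F i).
Proof.
elim: s => [|i s IHs]; first by rewrite !big_nil subrr.
rewrite !big_cons.
have /andP[Fi0 Fi1] := F01 i.
set p := \prod_(j <- s) F j in IHs *.
have -> : 1 - F i * p = (1 - F i) + F i * (1 - p) by ring.
rewrite lerD2l; apply: le_trans IHs; apply: ler_piMl => //.
by rewrite subr_ge0; apply: prodr_ile1 => j; rewrite F01.
Qed.

(** The inequality of arithmetic and geometric means for the numbers
[F i ^+ n.+1], after extraction of an [n.+1]-th root. *)
Lemma prod_le_mean_pow (R : realFieldType) (n : nat) (F : 'I_n.+1 -> R)
    (F_ge0 : forall i, 0 <= F i) :
  \prod_i F i <= \sum_i n.+1%:R^-1 * F i ^+ n.+1.
Proof.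
rewrite -mulr_sumr mulrC -(@ler_pXn2r _ n.+1) ?nnegrE //; last 2 first.
- exact: prodr_ge0.
- by rewrite divr_ge0 // sumr_ge0 // => i _; rewrite exprn_ge0.
rewrite -prodrXl.
have := @leif_AGM R 'I_n.+1 predT (fun i => F i ^+ n.+1).
rewrite /= card_ord => /(_ (fun i _ => exprn_ge0 _ (F_ge0 i))) [].
by [].
Qed.

Lemma one_sub_pow (R : pzRingType) (m : nat) (a : R) :
  1 - a ^+ m = (1 - a) * \sum_(k < m) a ^+ k.
Proof. by rewrite -opprB subrX1 -mulNr opprB. Qed.

Lemma geometric_ge1 (R : numDomainType) (n : nat) (a : R) : 0 <= a ->
  1 <= \sum_(k < n.+1) a ^+ k.
Proof.
move=> a0; rewrite big_ord_recl expr0 lerDl sumr_ge0// => k _.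
exact: exprn_ge0.
Qed.

(** The right side is the chord of the left one between [a = 0] and [a = 1].
After multiplication by the geometric sum the claim is that the mean of the
powers of [a] is at least the last of them. *)
Lemma inv_geometric_le (R : realFieldType) (n : nat) (a : R) : 0 <= a <= 1 ->
  (\sum_(k < n.+1) a ^+ k)^-1 <= 1 - a + a / n.+1%:R.
Proof.
move=> /andP[a0 a1]; set S := \sum_(k < _) _.
have S1 : 1 <= S by exact: geometric_ge1.
have S0 : 0 < S by exact: lt_le_trans S1.
rewrite -[leLHS]mul1r ler_pdivrMr //.
have geo : (1 - a) * S = 1 - a ^+ n.+1 by rewrite one_sub_pow.
have Slow : n.+1%:R * a ^+ n <= S.
  rewrite mulr_natl -[X in _ *+ X]card_ord -sumr_const; apply: ler_sum => k _.
  by apply: ler_wiXn2l => //; rewrite -ltnS.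
rewrite mulrDl geo -lerBlDl.
have -> : 1 - (1 - a ^+ n.+1) = a * a ^+ n by rewrite -exprS; ring.
rewrite -mulrA; apply: ler_wpM2l => //.
by rewrite mulrC ler_pdivlMr // mulrC.
Qed.

(** A point of the segment from [l] to [u] has the prescribed sum. *)
Lemma sum_interpolation (R : realFieldType) (I : finType) (l u : I -> R)
    (s : R) :
  (forall i, l i <= u i) -> \sum_i l i <= s -> s <= \sum_i u i ->
  exists2 a : I -> R, (forall i, l i <= a i <= u i) & \sum_i a i = s.
Proof.
move=> lu ls su; have [LU|LU] := eqVneq (\sum_i l i) (\sum_i u i).
  exists l; first by move=> i; rewrite lexx lu.
  by apply/eqP; rewrite eq_le ls /= LU.
have D0 : 0 < \sum_i u i - \sum_i l i.
  by rewrite subr_gt0 lt_neqAle LU (le_trans ls).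
pose t := (s - \sum_i l i) / (\sum_i u i - \sum_i l i).
have t0 : 0 <= t by rewrite divr_ge0 ?subr_ge0 // (le_trans ls).
have t1 : t <= 1 by rewrite ler_pdivrMr // mul1r lerD2r.
exists (fun i => l i + t * (u i - l i)).
  move=> i; have := lu i; rewrite -subr_ge0 => d0.
  rewrite lerDl mulr_ge0 //= -lerBrDl.
  by apply: ler_piMl.
rewrite big_split /= -mulr_sumr sumrB divfK ?gt_eqF //.
by rewrite addrC subrK.
Qed.

(** In both cases a geometric sum factors out: that of [a] if [f <= a], since
[f ^+ n.+1] is then at most [a ^+ n.+1], and that of [f] if [a <= f], since it
is then at least that of [a]. *)
Lemma one_sub_pow_lower_bound (R : realFieldType) (n : nat) (a f : R)
   (w := (\sum_(k < n.+1) a ^+ k)^-1) : 0 <= a <= 1 -> 0 <= f <= 1 ->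
  (f <= a -> 1 - a <= w * (1 - f ^+ n.+1)) /\
  (a <= f -> 1 - f <= w * (1 - f ^+ n.+1)).
Proof.
move=> /andP[a0 a1] /andP[f0 f1].
have S0 : 0 < \sum_(k < n.+1) a ^+ k.
  exact: lt_le_trans (geometric_ge1 _ a0).
split=> fa; rewrite /w mulrC ler_pdivlMr //.
  by rewrite -one_sub_pow lerD2l lerN2 lerXn2r ?nnegrE.
rewrite one_sub_pow ler_wpM2l ?subr_ge0 //.
by apply: ler_sum => k _; rewrite lerXn2r ?nnegrE.
Qed.

(** * The threshold and the pointwise domination *)

Lemma cvg_sumr (R : realFieldType) (T : Type) (G : set_system T)
    (FG : Filter G) (I : Type) (s : seq I) (f : I -> T -> R) (l : I -> R) :
  (forall i, f i x @[x --> G] --> l i) ->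
  \sum_(i <- s) f i x @[x --> G] --> \sum_(i <- s) l i.
Proof.
move=> fl; elim: s => [|i s IHs].
  by rewrite big_nil; under eq_fun do rewrite big_nil; exact: cvg_cst.
rewrite big_cons; under eq_fun do rewrite big_cons.
exact: cvgD.
Qed.

(** The sum of the [F i] increases from 0 to [n.+1], so it crosses [n] at some
[c], possibly by a jump.  The values [a i] split the jumps of the [F i] at [c]
in a common proportion so that the sum is exactly [n], that is, the [1 - a i]
sum to 1. *)
Lemma common_threshold (R : realType) (n : nat) (F : 'I_n.+1 -> R -> R)
    (F01 : forall i x, 0 <= F i x <= 1)
    (F_nd : forall i, nondecreasing_fun (F i))
    (F_rc : forall i, right_continuous (F i))
    (F_y1 : forall i, F i x @[x --> +oo] --> (1 : R))
    (F_neg : forall i (x : R), x < 0 -> F i x = 0) :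
  exists (c : R) (a : 'I_n.+1 -> R),
    [/\ forall i x, x < c -> F i x <= a i,
        forall i x, c <= x -> a i <= F i x & \sum_i a i = n%:R].
Proof.
pose H x := \sum_i F i x.
have H_nd : nondecreasing_fun H.
  by move=> x y xy; apply: ler_sum => i _; apply: F_nd.
(* If n = 0, the sum is at least n everywhere; bounding A below keeps its
   infimum meaningful. *)
pose A := [set x : R | 0 <= x /\ n%:R <= H x].
have H_y : H x @[x --> +oo] --> (n.+1%:R : R).
  have -> : n.+1%:R = \sum_(i < n.+1) (1 : R).
    by rewrite sumr_const card_ord.
  exact: cvg_sumr.
have A0 : A !=set0.
  have : \forall x \near +oo, n%:R <= H x.
    by apply: cvgr_ge H_y _ _; rewrite ltr_nat.
  move=> /(filterI (nbhs_pinfty_ge (num_real (0 : R))))/filter_ex[x [x0 Hx]].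
  by exists x.
have Ainf : has_inf A by split=> //; exists 0 => x [].
pose c := inf A.
have Hright (x : R) : c < x -> n%:R <= H x.
  move=> cx; have [y [_ Hy] yx] := inf_lt A0 cx.
  by apply: le_trans Hy _; apply: H_nd; exact: ltW.
have Hleft (x : R) : x < c -> H x <= n%:R.
  move=> xc; have [x0|x0] := ltP x 0.
    by rewrite /H big1 // => i _; exact: F_neg.
  rewrite leNgt; apply/negP => /ltW Hx.
  by move: xc; rewrite ltNge; apply/negP/negPn; apply: ge_inf => //; case: Ainf.
have Hc : n%:R <= H c.
  have : H x @[x --> c^'+] --> H c by apply: cvg_sumr => i; exact: F_rc.
  move=> Hcvg; apply: (cvgr_to_ge Hcvg); near=> x; apply: Hright.
  by near: x; exact: nbhs_right_gt.
have Fl_cvg i : cvg (F i x @[x --> c^'-]).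
  apply: nondecreasing_at_left_is_cvgr; near=> x.
    by move=> y z _ _; exact: F_nd.
  by exists 1 => _ [y _ <-]; case/andP: (F01 i y).
pose l i := lim (F i x @[x --> c^'-]).
have Fl i (x : R) : x < c -> F i x <= l i.
  move=> xc; apply: limr_ge => //; near=> y; apply: F_nd.
  by near: y; exact: nbhs_left_ge.
have lF i : l i <= F i c.
  apply: limr_le => //; near=> y; apply: F_nd.
  by near: y; exact: nbhs_left_le.
have Hl : \sum_i l i <= n%:R.
  have : H x @[x --> c^'-] --> \sum_i l i.
    by apply: cvg_sumr => i; exact: Fl_cvg.
  move=> Hcvg; apply: (cvgr_to_le Hcvg); near=> x; apply: Hleft.
  by near: x; exact: nbhs_left_lt.
have [a la sa] := sum_interpolation lF Hl Hc.
exists c, a; split=> // i x.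
  by move=> /(Fl i) /le_trans; apply; case/andP: (la i).
by move=> cx; case/andP: (la i) => _ /le_trans; apply; exact: F_nd.
Unshelve. all: by end_near. Qed.

(** The weights are the inverse geometric sums at the threshold values.  On the
left of the threshold the right side is at least the sum of the [1 - a i], which
is 1; from the threshold on it is at least the union bound. *)
Lemma one_sub_prod_dominated (R : realType) (n : nat) (F : 'I_n.+1 -> R -> R)
    (F01 : forall i x, 0 <= F i x <= 1)
    (F_nd : forall i, nondecreasing_fun (F i))
    (F_rc : forall i, right_continuous (F i))
    (F_y1 : forall i, F i x @[x --> +oo] --> (1 : R))
    (F_neg : forall i (x : R), x < 0 -> F i x = 0) :
  exists v : 'I_n.+1 -> R,
    [/\ forall i, 0 <= v i, \sum_i v i <= 2 - n.+1%:R^-1 &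
        forall x, 1 - \prod_i F i x <= \sum_i v i * (1 - F i x ^+ n.+1)].
Proof.
have [c [a [Fa aF sa]]] := common_threshold F01 F_nd F_rc F_y1 F_neg.
have a01 i : 0 <= a i <= 1.
  have /andP[F0 _] := F01 i (c - 1); have /andP[_ F1] := F01 i c.
  rewrite (le_trans F0) ?Fa ?gtrBl // (le_trans _ F1) ?aF //.
pose v i := (\sum_(k < n.+1) a i ^+ k)^-1.
exists v; split=> [i||x].
- rewrite invr_ge0 sumr_ge0 // => k _.
  by case/andP: (a01 i) => *; exact: exprn_ge0.
- apply: (@le_trans _ _ (\sum_i (1 - a i + a i / n.+1%:R))).
    by apply: ler_sum => i _; exact: inv_geometric_le.
  rewrite big_split /= sumrB -mulr_suml sa sumr_const card_ord.
  have N0 : n.+1%:R != 0 :> R by rewrite pnatr_eq0.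
  have -> : n%:R = n.+1%:R - 1 :> R by rewrite -natr1 addrK.
  set N : R := n.+1%:R in N0 *.
  have -> : (N - 1) / N = 1 - N^-1 by rewrite mulrBl divff // mul1r.
  by rewrite subKr addrA.
- have [xc|cx] := ltP x c.
    apply: (@le_trans _ _ (\sum_i (1 - a i))).
      rewrite sumrB sumr_const card_ord sa -natr1 addrAC subrr add0r gerBl.
      by apply: prodr_ge0 => i _; case/andP: (F01 i x).
    apply: ler_sum => i _.
    apply: (one_sub_pow_lower_bound n (a01 i) (F01 i x)).1.
    exact: Fa.
  apply: le_trans (one_sub_prod_le _ (fun i => F01 i x)) _.
  apply: ler_sum => i _.
  apply: (one_sub_pow_lower_bound n (a01 i) (F01 i x)).2.
  exact: aF.
Qed.

(** * Integration of tails *)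

Lemma ge0_integral_lincomb d (T : measurableType d) (R : realType)
    (mu : {measure set T -> \bar R}) (D : set T) (I : finType)
    (w : I -> R) (h : I -> T -> R) : measurable D ->
  (forall i, 0 <= w i) -> (forall i x, 0 <= h i x) ->
  (forall i, measurable_fun setT (h i)) ->
  (\int[mu]_(x in D) (\sum_i w i * h i x)%:E =
   \sum_i (w i)%:E * \int[mu]_(x in D) (h i x)%:E)%E.
Proof.
move=> mD w0 h0 mh.
under eq_integral do rewrite -sumEFin.
rewrite ge0_integral_sum //=.
- apply: eq_bigr => i _; under eq_integral do rewrite EFinM.
  rewrite ge0_integralZl_EFin // => [x _|]; first by rewrite lee_fin.
  by apply/measurable_EFinP/measurable_funTS.
- move=> i; apply/measurable_EFinP/measurable_funM => //.
  exact: measurable_funTS.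
- by move=> i x _; rewrite lee_fin mulr_ge0.
Qed.

Lemma one_sub_prod_ge0 (R : numDomainType) (n : nat) (F : 'I_n -> R)
    (F01 : forall i, 0 <= F i <= 1) :
  0 <= 1 - \prod_i F i.
Proof. by rewrite subr_ge0; apply: prodr_ile1. Qed.

Lemma measurable_one_sub_prod (R : realType) (n : nat) (F : 'I_n -> R -> R)
    (F0 : forall i x, 0 <= F i x)
    (F_nd : forall i, nondecreasing_fun (F i)) :
  measurable_fun setT (fun x => 1 - \prod_i F i x).
Proof.
apply: nonincreasing_measurable => // x y xy; rewrite lerD2l lerN2.
by apply: ler_prod => i _; rewrite F0 F_nd.
Qed.

Lemma one_sub_pow_ge0 (R : numDomainType) (n : nat) (f : R) :
  0 <= f <= 1 -> 0 <= 1 - f ^+ n.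
Proof. by move=> /andP[f0 f1]; rewrite subr_ge0 exprn_ile1. Qed.

Lemma measurable_one_sub_pow (R : realType) (n : nat) (f : R -> R) :
  (forall x, 0 <= f x) -> nondecreasing_fun f ->
  measurable_fun setT (fun x => 1 - f x ^+ n).
Proof.
move=> f0 f_nd; apply: nonincreasing_measurable => // x y xy.
by rewrite lerD2l lerN2 lerXn2r ?nnegrE // f_nd.
Qed.

(** * Distribution functions and expectations *)

Section distribution_function.
Context d (T : measurableType d) (R : realType) (P : probability T R).

(** A real-valued version of [cdf], so that products and powers of distribution
functions live in [R]. *)
Definition fine_cdf (X : {RV P >-> R}) (x : R) : R := fine (cdf X x).

Lemma EFin_fine_cdf X x : (fine_cdf X x)%:E = cdf X x.
Proof. by rewrite fineK ?fin_num_measure. Qed.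

Lemma fine_cdf_itv X x : 0 <= fine_cdf X x <= 1.
Proof. by rewrite -!lee_fin EFin_fine_cdf cdf_ge0 cdf_le1. Qed.

Lemma fine_cdf_nondecreasing X : nondecreasing_fun (fine_cdf X).
Proof. by move=> x y xy; rewrite -lee_fin !EFin_fine_cdf cdf_nondecreasing. Qed.

Lemma fine_cdf_right_continuous X : right_continuous (fine_cdf X).
Proof.
move=> x; apply: fine_cvg; rewrite EFin_fine_cdf; exact: cdf_right_continuous.
Qed.

Lemma cvg_fine_cdfy1 X : fine_cdf X x @[x --> +oo] --> (1 : R).
Proof. exact/fine_cvg/cvg_cdfy1. Qed.

Lemma ccdf_fine_cdf X x : ccdf X x = (1 - fine_cdf X x)%:E.
Proof. by rewrite ccdf_1_cdf -EFin_fine_cdf EFinB. Qed.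

Lemma fine_cdf_lt0 (X : {RV P >-> R}) (x : R) :
  (forall t, 0 <= X t) -> x < 0 -> fine_cdf X x = 0.
Proof.
move=> X0 x0; rewrite /fine_cdf /cdf /distribution /= /pushforward.
rewrite (_ : _ @^-1` _ = set0) ?measure0 //.
rewrite -subset0 => t /=; rewrite in_itv /= => Xx.
by have := lt_le_trans x0 (X0 t); rewrite ltNge Xx.
Qed.

(** The tail formula under almost sure non-negativity only: copies of a
non-negative variable may be negative on a null set.  The variable is replaced
by its positive part, which has the same upper tail on [x >= 0]. *)
Lemma ae_ge0_expectation_fine_cdf (X : {RV P >-> R}) :
  (forall x : R, x < 0 -> fine_cdf X x = 0) ->
  'E_P[X]%E =
  (\int[lebesgue_measure]_(x in `[0%R, +oo[) (1 - fine_cdf X x)%:E)%E.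
Proof.
move=> X_neg.
have Xneg0 : P.-negligible (X @^-1` `]-oo, 0[).
  apply: (@negligibleS _ _ _ P (\bigcup_k X @^-1` `]-oo, (- k.+1%:R^-1)])).
    move=> t /=; rewrite in_itv /= -oppr_gt0 => /ltr_add_invr[k].
    rewrite add0r => kX; exists k => //=.
    by rewrite in_itv /= lerNr ltW.
  apply: negligible_bigcup => k; apply/negligibleP.
    exact: measurable_funPTI.
  by apply: etrans (esym (EFin_fine_cdf X _)) _; rewrite X_neg // oppr_lt0.
have -> : 'E_P[X]%E = 'E_P[X^\+]%E.
  rewrite unlock; apply: ae_eq_integral => //.
  - exact/measurable_EFinP.
  - by apply/measurable_EFinP; exact: measurable_funrpos.
  apply: negligibleS Xneg0 => t /=; rewrite in_itv /= => h.
  rewrite ltNge; apply/negP => Xt0; apply: h => _.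
  by rewrite /funrpos; congr EFin; rewrite max_l.
rewrite ge0_expectation_ccdf; last by move=> t; exact: funrpos_ge0.
apply: eq_integral => x; rewrite inE /= in_itv /= andbT => x0.
rewrite -ccdf_fine_cdf /ccdf /distribution /= /pushforward; congr (P _).
apply/seteqP; split=> t /=; rewrite !in_itv /= !andbT /funrpos lt_max.
  by case/orP => //; rewrite ltNge x0.
by move=> ->.
Qed.

End distribution_function.

(** * Maxima and performances *)

Lemma family_max_le disp (V : orderType disp) (n : nat) (x : 'I_n.+1 -> V)
    (y : V) : (family_max x <= y)%O = [forall i, (x i <= y)%O].
Proof.
apply/idP/forallP => [/bigmax_leP[_ xy] i|xy]; first exact: xy.
by apply/bigmax_leP; split.
Qed.

Lemma le_family_max disp (V : orderType disp) (n : nat) (x : 'I_n.+1 -> V)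
    (i : 'I_n.+1) : (x i <= family_max x)%O.
Proof. exact: le_bigmax. Qed.

Lemma measurable_family_max d (T : measurableType d) (R : realType) (n : nat)
    (f : 'I_n.+1 -> T -> R) (mf : forall i, measurable_fun setT (f i)) :
  measurable_fun setT (fun t => family_max (fun i => f i t)).
Proof.
rewrite /family_max.
elim: (index_enum _) => [|i s IHs].
  by under eq_fun do rewrite big_nil; exact: mf.
under eq_fun do rewrite big_cons.
exact: measurable_maxr.
Qed.

Section performance_distribution_function.
Context d (T : measurableType d) (R : realType) (P : probability T R) (n : nat).
Implicit Type Z : 'I_n.+1 -> {RV P >-> R}.

(** A maximum is at most [x] exactly if every member is, so independence turns
the distribution function of the maximum into a product. *)
Lemma fine_cdf_family_max Z (W : {RV P >-> R}) (x : R) : independent_RVs Z ->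
  (forall t, W t = family_max (fun i => Z i t)) ->
  fine_cdf W x = \prod_i fine_cdf (Z i) x.
Proof.
move=> Z_indep WZ; apply: EFin_inj; rewrite EFin_fine_cdf -prodEFin.
transitivity (P (\bigcap_(i in [set` [set: 'I_n.+1]%SET])
    (Z i @^-1` `]-oo, x]))).
  rewrite /cdf /distribution /= /pushforward; congr (P _).
  apply/seteqP; split=> t /=; rewrite in_itv /= WZ family_max_le.
    by move=> /forallP Zx i _ /=; rewrite in_itv /= Zx.
  move=> Zx; apply/forallP => i.
  by have := Zx i; rewrite /= in_itv /= inE; apply.
rewrite Z_indep //; apply: eq_big => [i|i _]; first by rewrite inE.
by rewrite EFin_fine_cdf.
Qed.

Lemma performance_fine_cdf Z : independent_RVs Z ->
  (forall i (x : R), x < 0 -> fine_cdf (Z i) x = 0) ->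
  performance Z =
  (\int[lebesgue_measure]_(x in `[0%R, +oo[)
    (1 - \prod_i fine_cdf (Z i) x)%:E)%E.
Proof.
move=> Z_indep Z_neg.
have mW := measurable_family_max (fun i => measurable_funPT (Z i)).
pose W : {RV P >-> R} := mfun_Sub (mem_set mW).
have cdfW x : fine_cdf W x = \prod_i fine_cdf (Z i) x.
  exact: fine_cdf_family_max.
rewrite /performance -[X in expectation _ X]/(W : T -> R).
rewrite ae_ge0_expectation_fine_cdf.
  by apply: eq_integral => x _; rewrite cdfW.
by move=> x x0; rewrite cdfW big_ord_recl Z_neg // mul0r.
Qed.

End performance_distribution_function.

Lemma performance_copies d (T : measurableType d) d' (T' : measurableType d')
    (R : realType) (P : probability T R) (Q : probability T' R) (n : nat)
    (X : {RV P >-> R}) (Y : 'I_n.+1 -> {RV Q >-> R}) :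
  (forall t, 0 <= X t) -> independent_copies X Y ->
  performance Y =
  (\int[lebesgue_measure]_(x in `[0%R, +oo[) (1 - fine_cdf X x ^+ n.+1)%:E)%E.
Proof.
move=> X0 [Y_indep YX].
have cdfY j x : fine_cdf (Y j) x = fine_cdf X x by rewrite /fine_cdf /cdf -YX.
rewrite performance_fine_cdf //; last first.
  by move=> j x x0; rewrite cdfY fine_cdf_lt0.
apply: eq_integral => x _; congr (1 - _)%:E.
by under eq_bigr do rewrite cdfY; rewrite prodr_const card_ord.
Qed.

(** Bernoulli's inequality bounds the tail of the maximum by n.+1 times the
tail of [X], whose integral is the first moment of [X]. *)
Lemma performance_copies_lty d (T : measurableType d) d'
    (T' : measurableType d') (R : realType) (P : probability T R)
    (Q : probability T' R) (n : nat)
    (X : {RV P >-> R}) (Y : 'I_n.+1 -> {RV Q >-> R}) :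
  (forall t, 0 <= X t) -> P.-integrable setT (EFin \o X) ->
  independent_copies X Y -> (performance Y < +oo)%E.
Proof.
move=> X0 X_int X_copies; rewrite (performance_copies X0) //.
have F0 x : 0 <= fine_cdf X x by case/andP: (fine_cdf_itv X x).
have mtail := measurable_one_sub_pow _ F0 (@fine_cdf_nondecreasing _ _ _ _ X).
have tail0 x : 0 <= 1 - fine_cdf X x.
  exact: (one_sub_pow_ge0 1 (fine_cdf_itv X x)).
have EX_fin : ('E_P[X] \is a fin_num)%E.
  by rewrite unlock; apply: integrable_fin_num.
apply: (@le_lt_trans _ _ (\int[lebesgue_measure]_(x in `[0%R, +oo[)
    (n.+1%:R * (1 - fine_cdf X x))%:E)%E).
  apply: ge0_le_integral => //.
  - by move=> x _; rewrite lee_fin one_sub_pow_ge0 // fine_cdf_itv.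
  - by apply/measurable_EFinP/measurable_funTS; exact: mtail.
  - apply/measurable_EFinP/measurable_funTS/measurable_funM => //.
    exact: (mtail 1).
  move=> x _; rewrite lee_fin.
  have := one_sub_prod_le (index_enum 'I_n.+1) (fun _ => fine_cdf_itv X x).
  by rewrite prodr_const sumr_const card_ord mulr_natl.
under eq_integral do rewrite EFinM.
rewrite ge0_integralZl_EFin //.
- rewrite -ae_ge0_expectation_fine_cdf; last by move=> x; exact: fine_cdf_lt0.
  by rewrite -(fineK EX_fin) -EFinM ltry.
- by move=> x _; rewrite lee_fin.
- by apply/measurable_EFinP/measurable_funTS; exact: (mtail 1).
Qed.

(** * The mixing factor *)

Local Open Scope ereal_scope.

(* [n.+1] is the number of variables. *)
Theorem corollary2 (R : realType) (n : nat)
    (d : measure_display) (T : measurableType d) (P : probability T R)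
    (X : 'I_n.+1 -> {RV P >-> R})
    (d' : 'I_n.+1 -> measure_display)
    (T' : forall i : 'I_n.+1, measurableType (d' i))
    (Q : forall i : 'I_n.+1, probability (T' i) R)
    (Y : forall i : 'I_n.+1, 'I_n.+1 -> {RV (Q i) >-> R})
    (M : 'I_n.+1 -> \bar R)
    (X_indep : independent_RVs X)
    (X_ge0 : forall (i : 'I_n.+1) (t : T), (0 <= X i t)%R)
    (X_int : forall i : 'I_n.+1, P.-integrable setT (EFin \o X i))
    (Y_copies : forall i : 'I_n.+1, independent_copies (X i) (Y i))
    (M_def : forall i : 'I_n.+1, M i = performance (Y i))
    (M_gt0 : 0 < family_max M) :
  mixing_factor X M <= (2 - (n.+1%:R)^-1 : R)%:E /\
  ((forall i j : 'I_n.+1, M i = M j) -> 1 <= mixing_factor X M).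
Proof.
pose F i := fine_cdf (X i).
pose h i x := (1 - F i x ^+ n.+1)%R.
pose I (g : R -> R) : \bar R :=
  \int[lebesgue_measure]_(x in `[0%R, +oo[) (g x)%:E.
have F01 i x : (0 <= F i x <= 1)%R by exact: fine_cdf_itv.
have F0 i x : (0 <= F i x)%R by case/andP: (F01 i x).
have F_nd i : nondecreasing_fun (F i) by exact: fine_cdf_nondecreasing.
have F_rc i : right_continuous (F i) by exact: fine_cdf_right_continuous.
have F_y1 i : (F i x @[x --> +oo] --> (1 : R))%R by exact: cvg_fine_cdfy1.
have F_neg i (x : R) : (x < 0)%R -> F i x = 0%R.
  by apply: fine_cdf_lt0; exact: X_ge0.
have h0 i x : (0 <= h i x)%R by exact: one_sub_pow_ge0.
have mh i : measurable_fun setT (h i) by exact: measurable_one_sub_pow.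
have I_lincomb (w : 'I_n.+1 -> R) : (forall i, 0 <= w i)%R ->
    I (fun x => \sum_i w i * h i x)%R = \sum_i (w i)%:E * M i.
  move=> w0; rewrite /I ge0_integral_lincomb //.
  by apply: eq_bigr => i _; rewrite M_def (performance_copies (X_ge0 i)).
have E_def : performance X = I (fun x => 1 - \prod_i F i x)%R.
  by rewrite (performance_fine_cdf X_indep).
have tail0 x : (0 <= 1 - \prod_i F i x)%R by exact: one_sub_prod_ge0.
have mtail := measurable_one_sub_prod F0 F_nd.
have I_le (g1 g2 : R -> R) : measurable_fun setT g1 -> measurable_fun setT g2 ->
    (forall x, 0 <= g1 x <= g2 x)%R -> I g1 <= I g2.
  move=> mg1 mg2 g12; apply: ge0_le_integral => //.
  - by move=> x _; rewrite lee_fin; case/andP: (g12 x).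
  - exact/measurable_EFinP/measurable_funTS.
  - exact/measurable_EFinP/measurable_funTS.
  - by move=> x _; rewrite lee_fin; case/andP: (g12 x).
have mcomb (w : 'I_n.+1 -> R) :
    measurable_fun setT (fun x => \sum_i w i * h i x)%R.
  by apply: measurable_sum => i; apply: measurable_funM.
have comb0 (w : 'I_n.+1 -> R) x : (forall i, 0 <= w i)%R ->
    (0 <= \sum_i w i * h i x)%R.
  by move=> w0; apply: sumr_ge0 => i _; rewrite mulr_ge0.
have M_fin i : M i < +oo.
  by rewrite M_def (performance_copies_lty (X_ge0 i)).
(* The inverse of +oo is 0, so the lower bound depends on M_(n) being finite. *)
have [m m0 Mm] : exists2 m : R, (0 < m)%R & family_max M = m%:E.
  exists (fine (family_max M)).
    rewrite fine_gt0 // M_gt0 /=.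
    by apply/bigmax_ltP; split.
  by rewrite fineK // gt0_fin_numE //; apply/bigmax_ltP; split.
have mixE : mixing_factor X M = performance X * (m^-1)%:E.
  by rewrite /mixing_factor Mm inver gt_eqF.
rewrite mixE; split.
  have [v [v0 v_sum v_tail]] := one_sub_prod_dominated F01 F_nd F_rc F_y1 F_neg.
  rewrite lee_pdivrMr // E_def.
  apply: (@le_trans _ _ (I (fun x => \sum_i v i * h i x)%R)).
    by apply: I_le => // x; rewrite tail0 v_tail.
  rewrite I_lincomb //.
  apply: (@le_trans _ _ (\sum_i (v i)%:E * m%:E)).
    apply: lee_sum => i _; apply: lee_wpmul2l; first by rewrite lee_fin.
    by rewrite -Mm le_family_max.
  rewrite -ge0_sume_distrl; last by move=> i _; rewrite lee_fin.
  by rewrite sumEFin -!EFinM lee_fin ler_wpM2r // ltW.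
move=> M_eq.
have Mi i : M i = m%:E.
  apply/eqP; rewrite -Mm eq_le le_family_max family_max_le.
  by apply/forallP => j; rewrite (M_eq j i).
rewrite lee_pdivlMr // mul1e E_def.
have N0 : (0 <= n.+1%:R^-1 :> R)%R by rewrite invr_ge0.
apply: (@le_trans _ _ (I (fun x => \sum_(i < n.+1) n.+1%:R^-1 * h i x)%R)).
  rewrite I_lincomb //; under eq_bigr do rewrite Mi -EFinM.
  rewrite sumEFin sumr_const card_ord -[(_ * m *+ _)%R]mulr_natl.
  by rewrite mulrA divff ?mul1r // pnatr_eq0.
apply: I_le => // x; rewrite comb0 //=.
rewrite -mulr_sumr sumrB sumr_const card_ord mulrBr mulVf // lerD2l lerN2.
by rewrite mulr_sumr; exact: prod_le_mean_pow.
Qed.
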